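(* Let $(H\Lambda^\bullet, d_\bullet)$ be an exact Hilbert complex as in the context, fix $k \ge 1$, and set $V := H\Lambda^k$, $Q := H\Lambda^{k-1}$, $Y := V\times Q$. For $\alpha>0$ let $\mathcal{A} = \mathcal A_\alpha: Y \to Y'$ be the operator of the Hodge Laplacian in mixed form, $$\langle \mathcal{A}(u,p),(v,q)\rangle = (d_k u, d_k v)_\Omega + (d_{k-1}p, v)_\Omega + (u, d_{k-1}q)_\Omega - \alpha (p,q)_\Omega ,\qquad (u,p),(v,q)\in Y,$$ and let $\mathcal{P} = \mathcal P_\alpha: Y' = V'\times Q' \to Y$ be the linear operator $$\mathcal{P} := \begin{bmatrix} (1+\alpha)^{-1} I + d_k^* d_k & \\ & \alpha I + (1+\alpha) d_{k-1}^* d_{k-1}\end{bmatrix}^{-1}.$$ Then $\mathcal{P}$ is a parameter-robust norm-equivalent preconditioner for $\mathcal{A}$: there is a constant $c\ge 1$, independent of $\alpha$, such that for every $\alpha>0$ $$\kappa(\mathcal{P}\mathcal{A}) \le c .$$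
   Context: Setting. $\Omega\subset\mathbb{R}^n$ is a bounded Lipschitz domain, $(\cdot,\cdot)_\Omega$ and $\|\cdot\|_\Omega$ are the $L^2$ inner product and norm. $(H\Lambda^\bullet,d_\bullet)$ is a Hilbert complex: each $H\Lambda^k$ is a Hilbert space (of $L^2$ fields) with norm $\|v\|_k^2=\|v\|_\Omega^2+\|d_kv\|_\Omega^2$, and the linear differentials $d_k:H\Lambda^k\to H\Lambda^{k+1}$ satisfy $d_{k+1}d_k=0$ (spaces outside the index range are $0$). It is exact: every $q\in H\Lambda^k$ with $d_kq=0$ equals $d_{k-1}v$ for some $v\in H\Lambda^{k-1}$. The adjoint $d_k^*: H\Lambda^{k+1}\to H\Lambda^k$ is defined by $(d_k^*z,v)_\Omega=(z,d_kv)_\Omega$ for all $z\in H\Lambda^{k+1}$, $v\in H\Lambda^k$; it is a standing assumption that $d_k^*z\in H\Lambda^k$ exists for all $z$ (as is the case for a finite-dimensional (discrete) subcomplex of the de Rham complex, the case considered). The following standard facts for exact complexes are taken as available. Poincaré inequality: there are constants $c_k^P$ with $\|u\|_\Omega^2\le c_k^P\|d_ku\|_\Omega^2$ for all $u\in H\Lambda^k$ with $d_{k-1}^*u=0$. Hodge decomposition: every $v\in H\Lambda^k$ is uniquely $v=d_{k-1}w+d_k^*z$ with $w\in H\Lambda^{k-1}$, $d_{k-2}^*w=0$, $z\in H\Lambda^{k+1}$, $d_{k+1}z=0$, the summands being $L^2$-orthogonal. Conventions. $\alpha$ is a positive constant; primes denote dual spaces. The block operator whose inverse is $\mathcal P$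 is understood as the map $Y\to Y'$ given by the bilinear form $(1+\alpha)^{-1}(u,v)_\Omega+(d_ku,d_kv)_\Omega+\alpha(p,q)_\Omega+(1+\alpha)(d_{k-1}p,d_{k-1}q)_\Omega$. The condition number is $\kappa(T)=\|T\|\,\|T^{-1}\|$ with operator norms on $Y$ induced by the inner product just displayed (so the claim includes invertibility of $\mathcal A$). The complex and $k$ are fixed while $\alpha$ ranges over $(0,\infty)$. *)

(* Defs.v *)
From HB Require Import structures.
From mathcomp Require Import all_boot all_order all_algebra.
From mathcomp Require Import all_classical all_reals all_analysis.
From mathcomp Require Import ring.

Set Implicit Arguments.
Unset Strict Implicit.
Unset Printing Implicit Defensive.
Import Order.TTheory GRing.Theory Num.Theory.
Import numFieldNormedType.Exports.
Local Open Scope classical_set_scope.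
Local Open Scope ring_scope.

(* The degree of a form ranges over [int], so that k - 1 and k - 2 make sense,
   and the spaces outside the index range 0 .. hc_top are zero.
   The differential d_j : H j -> H (j + 1) is [hc_d j l] for any l with
   j + 1 = l; its adjoint d_j^* : H (j + 1) -> H j is [hc_dadj j l].  This
   avoids casts such as H (k - 1 + 1) = H k.  The maps [hc_d j l] with
   j + 1 != l carry no information and are never used.
   [hc_ip j] is the L^2 inner product, while the norm of the complete normed
   module [hc_space j] is the graph norm. *)
Record hilbert_complex (R : realType) := HilbertComplex {
  hc_top : nat ;
  hc_space :> int -> completeNormedModType R ;
  hc_ip : forall j, {dot (hc_space j) for idfun} ;
  hc_d : forall j l, {linear hc_space j -> hc_space l} ;
  hc_dadj : forall j l, hc_space l -> hc_space j ;
  hc_out : forall j : int, ~~ (0 <= j <= hc_top%:Z) ->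
    forall v : hc_space j, v = 0 ;
  hc_norm : forall j l : int, j + 1 = l -> forall v : hc_space j,
    `|v| ^+ 2 = hc_ip j v v + hc_ip l (hc_d j l v) (hc_d j l v) ;
  hc_dd : forall i j l : int, i + 1 = j -> j + 1 = l -> forall v : hc_space i,
    hc_d j l (hc_d i j v) = 0 ;
  hc_dadjE : forall j l : int, j + 1 = l ->
    forall (z : hc_space l) (v : hc_space j),
    hc_ip j (@hc_dadj j l z) v = hc_ip l z (hc_d j l v)
}.

Arguments hc_ip {R} _ {j}.
Arguments hc_d {R} _ j l.
Arguments hc_dadj {R} _ j l.

Definition exact_complex (R : realType) (C : hilbert_complex R) : Prop :=
  forall i j l : int, i + 1 = j -> j + 1 = l ->
  forall q : C j, hc_d C j l q = 0 -> exists v : C i, q = hc_d C i j v.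

Definition poincare_inequality (R : realType) (C : hilbert_complex R) : Prop :=
  forall i j l : int, i + 1 = j -> j + 1 = l ->
  exists cP : R, forall u : C j, hc_dadj C i j u = 0 ->
    hc_ip C u u <= cP * hc_ip C (hc_d C j l u) (hc_d C j l u).

Definition hodge_decomposition (R : realType) (C : hilbert_complex R) : Prop :=
  forall h i j l m : int, h + 1 = i -> i + 1 = j -> j + 1 = l -> l + 1 = m ->
  forall v : C j, exists! wz : C i * C l,
    [/\ v = hc_d C i j wz.1 + hc_dadj C j l wz.2,
        hc_dadj C h i wz.1 = 0,
        hc_d C l m wz.2 = 0 &
        hc_ip C (hc_d C i j wz.1) (hc_dadj C j l wz.2) = 0].

Record dual (R : realType) (V : normedModType R) := Dual {
  dual_fun :> V -> R ;
  dual_scalar : scalar dual_fun ;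
  dual_continuous : continuous dual_fun
}.

Section operator_norm.
Context {R : realType} {V : lmodType R} (ip : V -> V -> R).

Definition ip_norm (v : V) : R := Num.sqrt (ip v v).

(* Takes the value +oo on unbounded operators. *)
Definition opnorm (T : V -> V) : \bar R :=
  ereal_sup [set (ip_norm (T v))%:E | v in [set v | ip_norm v <= 1]].

End operator_norm.

Section continuity.
Context {R : realType} (C : hilbert_complex R).

Lemma hc_ip_ge0 j (u : C j) : 0 <= hc_ip C u u.
Proof.
have [->|u0] := eqVneq u 0; first by rewrite linear0r.
exact/ltW/neq0_dnorm_gt0.
Qed.

Lemma hc_ip_le_norm j (u : C j) : hc_ip C u u <= `|u| ^+ 2.
Proof. by rewrite (hc_norm (erefl (j + 1))) lerDl hc_ip_ge0. Qed.

Lemma hc_ip_sym j (u v : C j) : hc_ip C u v = hc_ip C v u.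
Proof. by rewrite hermC expr0 mul1r. Qed.

Lemma hc_cauchy_schwarz j (u v : C j) :
  hc_ip C u v ^+ 2 <= hc_ip C u u * hc_ip C v v.
Proof.
have [->|v0] := eqVneq v 0; first by rewrite linear0r expr0n mulr_ge0 ?hc_ip_ge0.
have vv : 0 < hc_ip C v v by exact: neq0_dnorm_gt0.
set a := hc_ip C v v; set b := hc_ip C u v.
have := hc_ip_ge0 (a *: u - b *: v).
rewrite !(linearBl, linearBr) !(linearZl, linearZr) /= (hc_ip_sym v u) -/a -/b.
rewrite (_ : _ - _ = a * (hc_ip C u u * a - b ^+ 2)).
  by rewrite pmulr_rge0// subr_ge0.
by rewrite /GRing.scale /=; ring.
Qed.

Lemma hc_ip_continuous j (u : C j) : continuous (fun v : C j => hc_ip C u v).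
Proof.
apply: (@bounded_linear_continuous R (C j) R^o (hc_ip C u)).
apply/linear_boundedP; exists `|u|; split=> //; move=> r ur x.
rewrite (@le_trans _ _ (`|u| * `|x|))//; last by rewrite ler_wpM2r// ltW.
rewrite -(@ler_pXn2r _ 2)// ?nnegrE ?mulr_ge0// real_normK ?num_real//.
rewrite exprMn (le_trans (hc_cauchy_schwarz _ _))//.
by rewrite ler_pM ?hc_ip_ge0 ?hc_ip_le_norm.
Qed.

Lemma hc_d_continuous j l : j + 1 = l -> continuous (hc_d C j l).
Proof.
move=> jl; apply: bounded_linear_continuous.
apply/linear_boundedP; exists 1; split=> //; move=> r r1 x.
rewrite (@le_trans _ _ `|x|)//; last by rewrite ler_peMl// ltW.
rewrite -(@ler_pXn2r _ 2)// ?nnegrE// (hc_norm jl) (hc_norm (erefl (l + 1))).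
by rewrite (hc_dd jl erefl) linear0r addr0 lerDr hc_ip_ge0.
Qed.

End continuity.

Section hodge_laplacian.
Context {R : realType} (C : hilbert_complex R) (k : int).

Definition hodge_space : normedModType R := (C k * C (k - 1))%type.

Local Notation Y := hodge_space.
Local Notation "''[' u , v ]" := (hc_ip C u v).
Local Notation dk := (hc_d C k (k + 1)).
Local Notation dk1 := (hc_d C (k - 1) k).

Definition hodge_form (alpha : R) (x y : Y) : R :=
  '[dk x.1, dk y.1] + '[dk1 x.2, y.1] + '[x.1, dk1 y.2] - alpha * '[x.2, y.2].

Definition precond_form (alpha : R) (x y : Y) : R :=
  (1 + alpha)^-1 * '[x.1, y.1] + '[dk x.1, dk y.1] +
  alpha * '[x.2, y.2] + (1 + alpha) * '[dk1 x.2, dk1 y.2].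

Let dk_cont : continuous dk := hc_d_continuous erefl.
Let dk1_cont : continuous dk1 := hc_d_continuous (subrK 1 k).

Let ip1 (u : C k) : continuous (fun y : Y => '[u, y.1]).
Proof.
by move=> y; apply: (continuous_comp cvg_fst); exact: hc_ip_continuous.
Qed.

Let ip2 (p : C (k - 1)) : continuous (fun y : Y => '[p, y.2]).
Proof.
by move=> y; apply: (continuous_comp cvg_snd); exact: hc_ip_continuous.
Qed.

Let ipd1 (w : C (k + 1)) : continuous (fun y : Y => '[w, dk y.1]).
Proof.
move=> y; apply: (@continuous_comp _ _ _ (fun y : Y => dk y.1)).
  by apply: (continuous_comp cvg_fst); exact: dk_cont.
exact: hc_ip_continuous.
Qed.

Let ipd2 (w : C k) : continuous (fun y : Y => '[w, dk1 y.2]).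
Proof.
move=> y; apply: (@continuous_comp _ _ _ (fun y : Y => dk1 y.2)).
  by apply: (continuous_comp cvg_snd); exact: dk1_cont.
exact: hc_ip_continuous.
Qed.

Lemma hodge_form_scalar alpha x : scalar (hodge_form alpha x).
Proof.
move=> a y z; rewrite /hodge_form /= !linearP !linearDr !linearZr /=.
by rewrite /GRing.scale /=; ring.
Qed.

Lemma precond_form_scalar alpha x : scalar (precond_form alpha x).
Proof.
move=> a y z; rewrite /precond_form /= !linearP !linearDr !linearZr /=.
by rewrite /GRing.scale /=; ring.
Qed.

Lemma hodge_form_continuous alpha x : continuous (hodge_form alpha x).
Proof.
move=> y; apply: cvgB; last by apply: cvgM; [exact: cvg_cst|exact: ip2].
apply: cvgD; last exact: ipd2.
by apply: cvgD; [exact: ipd1|exact: ip1].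
Qed.

Lemma precond_form_continuous alpha x : continuous (precond_form alpha x).
Proof.
move=> y; apply: cvgD; last by apply: cvgM; [exact: cvg_cst|exact: ipd2].
apply: cvgD; last by apply: cvgM; [exact: cvg_cst|exact: ip2].
apply: cvgD; last exact: ipd1.
by apply: cvgM; [exact: cvg_cst|exact: ip1].
Qed.

Definition hodge_op (alpha : R) (x : Y) : dual Y :=
  Dual (hodge_form_scalar alpha x) (@hodge_form_continuous alpha x).

Definition precond_inv (alpha : R) (x : Y) : dual Y :=
  Dual (precond_form_scalar alpha x) (@precond_form_continuous alpha x).

(* [pinv setT f] is the inverse function of f whenever f is bijective. *)
Definition precond (alpha : R) : dual Y -> Y := pinv setT (precond_inv alpha).

Definition condition_number (alpha : R) (T : Y -> Y) : \bar R :=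
  (opnorm (precond_form alpha) T *
   opnorm (precond_form alpha) (pinv setT T))%E.

End hodge_laplacian.

Arguments hodge_form {R} C k alpha x y.
Arguments precond_form {R} C k alpha x y.
Arguments hodge_op {R} C k alpha x.
Arguments precond_inv {R} C k alpha x.
Arguments precond {R} C k alpha f : rename.
Arguments condition_number {R} C k alpha T.

(* Main.v *)
Require Import Defs.
From HB Require Import structures.
From mathcomp Require Import all_boot all_order all_algebra.
From mathcomp Require Import all_classical all_reals all_analysis.
From mathcomp Require Import ring lra.

Set Implicit Arguments.
Unset Strict Implicit.
Unset Printing Implicit Defensive.
Import Order.TTheory GRing.Theory Num.Theory.
Import numFieldNormedType.Exports.
Local Open Scope classical_set_scope.
Local Open Scope ring_scope.

(* P denotes the inner product of the preconditioner, T := precond \o hodge_op,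
   so that P (T x) y = a x y for the Hodge-Laplace form a.  By Cauchy-Schwarz
   P (T x) (T x) <= 4 P x x.  Conversely, for x = (u, p) with Hodge decomposition
   u = d w + d^* z, the test pair
     y = (u + (1 + alpha) d p, w / ((1 + alpha) (1 + K)) - p),
   K a Poincare constant for w, gives P x x <= c a x y and P y y <= c P x x with
   c independent of alpha, whence P x x <= c^3 P (T x) (T x).
   Surjectivity of hodge_op then follows from Riesz' theorem for the inner
   product (x, y) |-> P (T x) (T y), which is equivalent to P and equals
   a (T x) y. *)

(** * Semi-inner products and Riesz representation *)

Lemma discriminant_le (R : realFieldType) (A B D : R) :
  (forall t, 0 <= A - 2 * t * B + t ^+ 2 * D) -> 0 <= D -> B ^+ 2 <= A * D.
Proof.
move=> H; rewrite le_eqVlt => /predU1P[D0|D0].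
  have [->|B0] := eqVneq B 0; first by rewrite -D0 expr0n mulr0.
  (* For [D = 0] the expression is affine in [t], and at this [t] it equals [-1]. *)
  have := H ((A + 1) / (2 * B)).
  rewrite -D0 mulr0 addr0 (_ : 2 * _ * _ = A + 1); first by lra.
  by field.
have := H (B / D); rewrite (_ : A - _ + _ = (A * D - B ^+ 2) / D).
  by rewrite pmulr_lge0 ?invr_gt0// subr_ge0.
by field; rewrite gt_eqF.
Qed.

(** Stated for a bare form, so that the same space can carry both [P] and the form
    [P (T x) (T y)]. *)
Record pre_inner (R : realType) (E : lmodType R) (b : E -> E -> R) : Prop :=
  PreInner {
    inner_sym : forall x y, b x y = b y x ;
    inner_lin : forall x, scalar (b x) ;
    inner_ge0 : forall x, 0 <= b x x
  }.

(** Completeness for the seminorm [sqrt (b x x)], phrased without a topology on [E] so that it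
    transfers between equivalent forms. *)
Definition seq_complete (R : realType) (E : lmodType R) (b : E -> E -> R) :=
  forall u : nat -> E,
    (forall e : R, 0 < e -> exists N, forall m n, (N <= m)%N -> (N <= n)%N ->
       b (u m - u n) (u m - u n) <= e) ->
    exists x, forall e : R, 0 < e -> exists n, forall m, (n <= m)%N ->
       b (u m - x) (u m - x) <= e.

Section pre_inner_theory.
Context {R : realType} {E : lmodType R} {b : E -> E -> R} (bP : pre_inner b).
Implicit Types (x y z : E) (t : R).

Lemma innerDr x y z : b x (y + z) = b x y + b x z.
Proof. by have := inner_lin bP x 1 y z; rewrite !scale1r /= mul1r. Qed.

Lemma innerr0 x : b x 0 = 0.
Proof. by have := innerDr x 0 0; rewrite addr0; lra. Qed.

Lemma innerZr t x y : b x (t *: y) = t * b x y.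
Proof. by have := inner_lin bP x t y 0; rewrite !addr0 innerr0 addr0. Qed.

Lemma innerBr x y z : b x (y - z) = b x y - b x z.
Proof. by rewrite -scaleN1r innerDr innerZr mulN1r. Qed.

Lemma innerDl x y z : b (y + z) x = b y x + b z x.
Proof. by rewrite (inner_sym bP) innerDr !(inner_sym bP x). Qed.

Lemma innerZl t x y : b (t *: y) x = t * b y x.
Proof. by rewrite (inner_sym bP) innerZr (inner_sym bP x). Qed.

Lemma innerBl x y z : b (y - z) x = b y x - b z x.
Proof. by rewrite (inner_sym bP) innerBr !(inner_sym bP x). Qed.

Lemma inner_CS x y : b x y ^+ 2 <= b x x * b y y.
Proof.
apply: discriminant_le => [t|]; last exact: inner_ge0.
have := inner_ge0 bP (x - t *: y).
rewrite !(innerBl, innerBr, innerZl, innerZr) (inner_sym bP y x).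
by rewrite (_ : _ - _ = b x x - 2 * t * b x y + t ^+ 2 * b y y) //; ring.
Qed.

(* The representative is a minimiser of J x = b x x - 2 f x: minimising
   sequences are Cauchy by the parallelogram identity. *)
Lemma riesz_representation (f : E -> R) (K : R) :
  seq_complete b -> scalar f -> 0 <= K ->
  (forall x, f x ^+ 2 <= K * b x x) ->
  exists x, forall y, b x y = f y.
Proof.
move=> bcomp flin K0 fK.
have fD x y t : f (x + t *: y) = f x + t * f y.
  by rewrite addrC flin /= addrC.
pose J x := b x x - 2 * f x.
(* By AM-GM, [(2 * f x) ^+ 2 <= 4 * K * b x x <= (K + b x x) ^+ 2]. *)
have JK x : - K <= J x.
  have : (2 * f x) ^+ 2 <= (K + b x x) ^+ 2.
    have := fK x; have : 0 <= (K - b x x) ^+ 2 by exact: sqr_ge0.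
    nra.
  have := inner_ge0 bP x.
  by move=> b0 h; rewrite /J; have [] := lerP (2 * f x) (K + b x x); nra.
pose S := [set J x | x in setT].
have Slb : has_lbound S by exists (- K) => _ [x _ <-].
have Sinf : has_inf S by split=> //; exists (J 0); exists 0.
pose m := inf S.
have mJ x : m <= J x by apply: ge_inf => //; exists x.
have [r r0 r_small] : exists2 r : nat -> R, forall n, 0 < r n &
    forall e : R, 0 < e -> exists N, forall n, (N <= n)%N -> r n <= e.
  exists (fun n => n.+1%:R^-1) => [n|e e0]; first by rewrite invr_gt0 ltr0n.
  exists (Num.truncn e^-1) => n Nn.
  rewrite -[leRHS]invrK lef_pV2 ?posrE ?invr_gt0//.
  by rewrite (le_trans (ltW (truncnS_gt _)))// ler_nat.
have /choice[u uP] (n : nat) : exists x, J x <= m + r n.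
  by have [_ [x _ <-] /ltW] := inf_adherent (r0 n) Sinf; exists x.
have [|x xP] := bcomp u.
  move=> e e0; have [|N NP] := r_small (e / 4); first by rewrite divr_gt0.
  exists N => i j /NP hi /NP hj.
  (* Testing the midpoint gives [b (u i - u j) (u i - u j) <= 2 * (r i + r j)], hence the tolerance
     [e / 4]. *)
  have := mJ (2^-1 *: (u i + u j)); have := uP i; have := uP j.
  have -> : J (2^-1 *: (u i + u j)) =
    2^-1 * (J (u i) + J (u j)) - 4^-1 * b (u i - u j) (u i - u j).
    have f0 : f 0 = 0 by have := fD 0 0 1; rewrite scaler0 addr0; lra.
    rewrite /J; have -> : f (2^-1 *: (u i + u j)) = 2^-1 * (f (u i) + f (u j)).
      by rewrite -[X in f X]add0r fD f0 add0r -{1}[u j]scale1r fD mul1r.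
    rewrite !(innerBl, innerBr, innerZl, innerZr, innerDl, innerDr).
    by rewrite (inner_sym bP (u j) (u i)); field.
  by lra.
exists x => y.
(* The Euler equation holds up to two defects: [u n] is nearly stationary for [J], and it is close
   to [x]. Each contributes [2 * e * b y y]. *)
have small (e : R) : 0 < e -> (b x y - f y) ^+ 2 <= 4 * e * b y y.
  move=> e0; have [N NP] := r_small e e0; have [M MP] := xP e e0.
  pose n := maxn N M.
  (* Since [u n] minimises [J] up to [r n], the quadratic [r n - 2 * t * (f y - b (u n) y) + t ^+ 2
     * b y y] is nonnegative for every [t]. *)
  have h1 : (f y - b (u n) y) ^+ 2 <= r n * b y y.
    apply: discriminant_le => [t|]; last exact: inner_ge0.
    have := mJ (u n + t *: y); have := uP n.
    rewrite /J fD !(innerZl, innerZr, innerDl, innerDr).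
    by rewrite (inner_sym bP y (u n)); lra.
  have h2 := inner_CS (u n - x) y; rewrite innerBl in h2.
  have h3 := ler_wpM2r (inner_ge0 bP y) (NP n (leq_maxl _ _)).
  have h4 := ler_wpM2r (inner_ge0 bP y) (MP n (leq_maxr _ _)).
  have := sqr_ge0 ((b (u n) y - b x y) - (f y - b (u n) y)).
  by move: h1 h2 h3 h4; rewrite !expr2; nra.
apply/eqP; rewrite -subr_eq0 -sqrf_eq0 eq_le sqr_ge0 andbT leNgt.
apply/negP => Z0; set Z := _ ^+ 2 in Z0.
have D0 := inner_ge0 bP y.
have D1 : 0 < 8 * (b y y + 1) by lra.
(* For this [e] the bound [4 * e * b y y] falls below [Z]; the [+ 1] covers [b y y = 0]. *)
have := small (Z / (8 * (b y y + 1))) (divr_gt0 Z0 D1).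
rewrite -/Z (_ : 4 * _ * _ = Z * ((4 * b y y) / (8 * (b y y + 1)))).
  rewrite leNgt gtr_pMr // => /negP; apply.
  by rewrite ltr_pdivrMr//; lra.
by field; rewrite gt_eqF// ; lra.
Qed.
End pre_inner_theory.

(** * Bounded functionals, Cauchy sequences and bijections *)

Lemma dual_bounded (R : realType) (V : normedModType R) (f : dual V) :
  exists2 M : R, 0 < M & forall v, `|f v| <= M * `|v|.
Proof.
pose g : {linear V -> R^o} :=
  HB.pack (dual_fun f) (GRing.isLinear.Build R V R^o *:%R f (dual_scalar f)).
have gb : bounded_near g (nbhs 0).
  by apply: (@continuous_linear_bounded _ _ _ 0 g); exact: dual_continuous.
have /linear_boundedP gM := gb.
have [M [M0 fM]] := filter_ex (filterI (nbhs_pinfty_gt (num_real 0)) gM).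
by exists M.
Qed.

Lemma dual_eq (R : realType) (V : normedModType R) (f g : dual V) :
  f =1 g -> f = g.
Proof.
case: f g => [f fs fc] [g gs gc] /= /funext fg; subst g.
by congr Dual; exact: Prop_irrelevance.
Qed.

Lemma complete_cauchy_seq (R : realType) (V : completeNormedModType R)
    (u : nat -> V) :
  (forall e : R, 0 < e -> exists N, forall m n, (N <= m)%N -> (N <= n)%N ->
     `|u m - u n| <= e) ->
  exists x, forall e : R, 0 < e -> exists N, forall n, (N <= n)%N ->
     `|u n - x| <= e.
Proof.
move=> uC.
have /cauchy_cvgP/cvg_ex[x ux] : cauchy (u @ \oo).
  (* Halving [e] turns the non-strict Cauchy bound into the strict one of an open ball. *)
  apply: cauchy_exP => e e0; have [N NP] := uC (e / 2) (divr_gt0 e0 (ltr0Sn _ _)).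
  exists (u N); exists N => // n /= Nn; rewrite -ball_normE /=.
  by rewrite (le_lt_trans (NP N n (leqnn N) Nn))// gtr_pMr// invf_lt1// ltr1n.
exists x => e e0.
have /cvgrPdist_le/(_ e e0)[N _ NP] := ux.
by exists N => n Nn; rewrite distrC; exact: NP.
Qed.

Lemma bijective_inj_surj (T U : Type) (f : T -> U) :
  injective f -> (forall y, exists x, f x = y) -> bijective f.
Proof. by move=> f_inj /choice[g gK]; exists g => // x; exact: f_inj. Qed.

(** * The preconditioner form and the continuity of the Hodge-Laplace form *)

Section hodge_laplacian_theory.
Context {R : realType} (C : hilbert_complex R) (k : int).

Local Notation Y := (hodge_space C k).
Local Notation "''[' u , v ]" := (hc_ip C u v).
Local Notation dk := (hc_d C k (k + 1)).
Local Notation dk1 := (hc_d C (k - 1) k).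
Local Notation P := (precond_form C k).
Local Notation a := (hodge_form C k).

Lemma hc_ip_eq0 j (u : C j) : '[u, u] = 0 -> u = 0.
Proof.
move=> u0; apply/eqP; apply: contraT => un0.
have : 0 < '[u, u] by exact: neq0_dnorm_gt0.
by rewrite u0 ltxx.
Qed.

Lemma hc_ipDl j (u v w : C j) : '[u + v, w] = '[u, w] + '[v, w].
Proof. exact: linearDl. Qed.

Lemma hc_ipDr j (u v w : C j) : '[w, u + v] = '[w, u] + '[w, v].
Proof. exact: linearDr. Qed.

Lemma hc_ipBl j (u v w : C j) : '[u - v, w] = '[u, w] - '[v, w].
Proof. exact: linearBl. Qed.

Lemma hc_ipBr j (u v w : C j) : '[w, u - v] = '[w, u] - '[w, v].
Proof. exact: linearBr. Qed.

Lemma hc_ipZl j t (u w : C j) : '[t *: u, w] = t * '[u, w].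
Proof. by rewrite linearZl. Qed.

Lemma hc_ipZr j t (u w : C j) : '[w, t *: u] = t * '[w, u].
Proof. exact: linearZr. Qed.

Lemma hodge_form_sym alpha x y : a alpha x y = a alpha y x.
Proof.
rewrite /hodge_form (hc_ip_sym (dk x.1)) (hc_ip_sym (dk1 x.2)).
by rewrite (hc_ip_sym x.1) (hc_ip_sym x.2); ring.
Qed.

Section alpha.
Context (alpha : R) (alpha0 : 0 < alpha).

Let alpha1 : 0 < 1 + alpha. Proof. by rewrite addr_gt0. Qed.

Lemma precond_pre_inner : pre_inner (P alpha : Y -> Y -> R).
Proof.
split=> [x y| |x]; last 1 first.
- have [ge0a ge0a1] := (ltW alpha0, ltW alpha1).
  by rewrite /precond_form !addr_ge0 ?mulr_ge0 ?invr_ge0 ?hc_ip_ge0.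
- rewrite /precond_form (hc_ip_sym x.1) (hc_ip_sym x.2).
  by rewrite (hc_ip_sym (dk x.1)) (hc_ip_sym (dk1 x.2)).
- exact: precond_form_scalar.
Qed.

(** The product norm is the maximum of two graph norms, so one component is estimated at a time. The
    constant blows up as [alpha] tends to 0 or infinity; this is harmless, since it serves only
    completeness, definiteness and boundedness of functionals at a fixed [alpha]. *)
Lemma norm_sqr_le_precond (x : Y) :
  `|x| ^+ 2 <= (2 + alpha + alpha^-1) * P alpha x x.
Proof.
have [u0 du0] := (hc_ip_ge0 x.1, hc_ip_ge0 (dk x.1)).
have [p0 dp0] := (hc_ip_ge0 x.2, hc_ip_ge0 (dk1 x.2)).
have ai : 0 < alpha^-1 by rewrite invr_gt0.
have a1i : 0 < (1 + alpha)^-1 by rewrite invr_gt0.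
rewrite prod_normE /precond_form.
set U := '[x.1, x.1] in u0 *; set DU := '[dk x.1, _] in du0 *.
set Q := '[x.2, x.2] in p0 *; set DQ := '[dk1 x.2, _] in dp0 *.
have Ua : U = (1 + alpha) * ((1 + alpha)^-1 * U) by rewrite mulVKf// gt_eqF.
have Qa : Q = alpha^-1 * (alpha * Q) by rewrite mulKf// gt_eqF.
have U0' : 0 <= (1 + alpha)^-1 * U by rewrite mulr_ge0// ltW.
have Q0' : 0 <= alpha * Q by rewrite mulr_ge0// ltW.
have aDQ : 0 <= alpha * DQ by rewrite mulr_ge0// ltW.
set S := _ + _ + _ + _.
have S1 : (1 + alpha)^-1 * U + DU <= S by rewrite /S; lra.
have S2 : alpha * Q + DQ <= S by rewrite /S; lra.
have S0 : 0 <= S by lra.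
have aS : 0 <= alpha * S by rewrite mulr_ge0// ltW.
have iS : 0 <= alpha^-1 * S by rewrite mulr_ge0// ltW.
rewrite !(mulrDl _ _ S).
have [_|_] := leP `|x.1| `|x.2|.
  rewrite (hc_norm (subrK 1 k)) -/Q -/DQ Qa.
  have : alpha^-1 * (alpha * Q) <= alpha^-1 * S by rewrite ler_pM2l//; lra.
  by lra.
rewrite (hc_norm (erefl (k + 1))) -/U -/DU Ua.
have : (1 + alpha) * ((1 + alpha)^-1 * U) <= (1 + alpha) * S.
  by rewrite ler_pM2l//; lra.
by rewrite mulrDl; lra.
Qed.

Lemma precond_le_norm_sqr (x : Y) : P alpha x x <= (3 + alpha) * `|x| ^+ 2.
Proof.
have [u0 du0] := (hc_ip_ge0 x.1, hc_ip_ge0 (dk x.1)).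
have [p0 dp0] := (hc_ip_ge0 x.2, hc_ip_ge0 (dk1 x.2)).
have n1 : `|x.1| ^+ 2 <= `|x| ^+ 2.
  by rewrite ler_pXn2r// ?nnegrE// prod_normE le_max lexx.
have n2 : `|x.2| ^+ 2 <= `|x| ^+ 2.
  by rewrite ler_pXn2r// ?nnegrE// prod_normE le_max lexx orbT.
move: n1 n2; rewrite (hc_norm (erefl (k + 1))) (hc_norm (subrK 1 k)).
rewrite /precond_form; set n := _ ^+ 2 => n1 n2.
have : (1 + alpha)^-1 * '[x.1, x.1] <= '[x.1, x.1].
  by rewrite ler_piMl// invf_le1// lerDl ltW.
have : (1 + alpha) * ('[x.2, x.2] + '[dk1 x.2, dk1 x.2]) <= (1 + alpha) * n.
  by rewrite ler_pM2l.
by lra.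
Qed.

Lemma precond_complete : seq_complete (P alpha : Y -> Y -> R).
Proof.
set M := 2 + alpha + alpha^-1; have M0 : 0 < M.
  by rewrite /M !addr_gt0// invr_gt0.
move=> u uC.
have nC (e : R) : 0 < e -> exists N, forall m n, (N <= m)%N -> (N <= n)%N ->
    `|u m - u n| <= e.
  move=> e0; have [|N NP] := uC (e ^+ 2 / M).
    by rewrite divr_gt0// exprn_gt0.
  exists N => m n mN nN.
  rewrite -(@ler_pXn2r _ 2)// ?nnegrE ?(ltW e0)//.
  rewrite (le_trans (norm_sqr_le_precond _))// mulrC -ler_pdivlMr//.
  exact: NP.
have [|x1 x1P] := @complete_cauchy_seq _ _ (fun n => (u n).1).
  move=> e e0; have [N NP] := nC e e0; exists N => m n mN nN.
  by rewrite (le_trans _ (NP m n mN nN))// prod_normE le_max lexx.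
have [|x2 x2P] := @complete_cauchy_seq _ _ (fun n => (u n).2).
  move=> e e0; have [N NP] := nC e e0; exists N => m n mN nN.
  by rewrite (le_trans _ (NP m n mN nN))// prod_normE le_max lexx orbT.
exists (x1, x2) => e e0.
have A0 : 0 < 3 + alpha by rewrite addr_gt0.
have d0 : 0 < e / (3 + alpha) by rewrite divr_gt0.
have [N1 N1P] := x1P (Num.sqrt (e / (3 + alpha))) ltac:(by rewrite sqrtr_gt0).
have [N2 N2P] := x2P (Num.sqrt (e / (3 + alpha))) ltac:(by rewrite sqrtr_gt0).
exists (maxn N1 N2) => m; rewrite geq_max => /andP[m1 m2].
rewrite (le_trans (precond_le_norm_sqr _))// mulrC -ler_pdivlMr//.
rewrite -[leRHS]sqr_sqrtr ?(ltW d0)// ler_pXn2r ?nnegrE ?sqrtr_ge0//.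
by rewrite prod_normE ge_max N1P//= N2P.
Qed.

(** The weights of [P] match under Cauchy-Schwarz: [1 + alpha] on d p meets [(1 + alpha)^-1] on v,
    so [alpha] cancels. The factor 4 comes from squaring a sum of four terms. *)
Lemma hodge_form_bound (x y : Y) :
  a alpha x y ^+ 2 <= 4 * (P alpha x x * P alpha y y).
Proof.
have [u0 du0] := (hc_ip_ge0 x.1, hc_ip_ge0 (dk x.1)).
have [p0 dp0] := (hc_ip_ge0 x.2, hc_ip_ge0 (dk1 x.2)).
have [v0 dv0] := (hc_ip_ge0 y.1, hc_ip_ge0 (dk y.1)).
have [q0 dq0] := (hc_ip_ge0 y.2, hc_ip_ge0 (dk1 y.2)).
have t1 := hc_cauchy_schwarz (dk x.1) (dk y.1).
have t2 := hc_cauchy_schwarz (dk1 x.2) y.1.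
have t3 := hc_cauchy_schwarz x.1 (dk1 y.2).
have t4 := hc_cauchy_schwarz x.2 y.2.
have a1i : 0 < (1 + alpha)^-1 by rewrite invr_gt0.
have aa1 : (1 + alpha) * (1 + alpha)^-1 = 1 by rewrite divff ?gt_eqF.
rewrite /hodge_form /precond_form.
move: ('[dk x.1, dk y.1]) ('[dk1 x.2, y.1]) ('[x.1, dk1 y.2]) ('[x.2, y.2])
  t1 t2 t3 t4 => T1 T2 T3 T4.
move: '[x.1, x.1] '[x.2, x.2] '[dk x.1, dk x.1] '[dk1 x.2, dk1 x.2]
  u0 p0 du0 dp0 => u p du dp u0 p0 du0 dp0.
move: '[y.1, y.1] '[y.2, y.2] '[dk y.1, dk y.1] '[dk1 y.2, dk1 y.2]
  v0 q0 dv0 dq0 => v q dv dq v0 q0 dv0 dq0 t1 t2 t3 t4.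
have : (T1 + T2 + T3 - alpha * T4) ^+ 2 <=
    4 * (T1 ^+ 2 + T2 ^+ 2 + T3 ^+ 2 + (alpha * T4) ^+ 2).
  have := sqr_ge0 (T1 - T2); have := sqr_ge0 (T1 - T3).
  have := sqr_ge0 (T2 - T3); have := sqr_ge0 (T1 + alpha * T4).
  have := sqr_ge0 (T2 + alpha * T4); have := sqr_ge0 (T3 + alpha * T4).
  move: (alpha * T4) => S; nra.
move/le_trans; apply; rewrite ler_pM2l//.
have t2' : T2 ^+ 2 <= ((1 + alpha) * dp) * ((1 + alpha)^-1 * v).
  by rewrite mulrACA aa1 mul1r.
have t3' : T3 ^+ 2 <= ((1 + alpha)^-1 * u) * ((1 + alpha) * dq).
  by rewrite mulrACA mulVf ?gt_eqF// mul1r.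
have t4' : (alpha * T4) ^+ 2 <= (alpha * p) * (alpha * q).
  by rewrite mulrACA exprMn -expr2 ler_pM2l// exprn_gt0.
have : 0 <= (1 + alpha) * dp by rewrite mulr_ge0// ltW.
have : 0 <= (1 + alpha) * dq by rewrite mulr_ge0// ltW.
have : 0 <= (1 + alpha)^-1 * u by rewrite mulr_ge0// ltW.
have : 0 <= (1 + alpha)^-1 * v by rewrite mulr_ge0// ltW.
have : 0 <= alpha * p by rewrite mulr_ge0// ltW.
have : 0 <= alpha * q by rewrite mulr_ge0// ltW.
move: ((1 + alpha) * dp) ((1 + alpha) * dq) ((1 + alpha)^-1 * u)
  ((1 + alpha)^-1 * v) (alpha * p) (alpha * q) t2' t3' t4'.
move: (_ ^+ 2) (_ ^+ 2) (_ ^+ 2) (_ ^+ 2) t1 => S1 S2 S3 S4 t1.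
move=> dp' dq' u' v' p' q' t2' t3' t4' h1 h2 h3 h4 h5 h6.
(* The four products are distinct terms in the expansion of [P x x * P y y]. *)
have hU : u' * dq' <= u' * (v' + dv + q' + dq') by rewrite ler_wpM2l//; lra.
have hDU : du * dv <= du * (v' + dv + q' + dq') by rewrite ler_wpM2l//; lra.
have hP : p' * q' <= p' * (v' + dv + q' + dq') by rewrite ler_wpM2l//; lra.
have hD : dp' * v' <= dp' * (v' + dv + q' + dq') by rewrite ler_wpM2l//; lra.
by rewrite !(mulrDl _ _ (v' + _ + _ + _)); lra.
Qed.

Lemma dual_bounded_precond (f : dual Y) :
  exists2 M : R, 0 <= M & forall x, f x ^+ 2 <= M * P alpha x x.
Proof.
have [M M0 fM] := dual_bounded f.
have ai : 0 < alpha^-1 by rewrite invr_gt0.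
exists (M ^+ 2 * (2 + alpha + alpha^-1)) => [|x].
  by rewrite mulr_ge0 ?sqr_ge0// !addr_ge0// ltW.
rewrite -mulrA (le_trans (_ : _ <= (M * `|x|) ^+ 2))//.
  by rewrite -real_normK ?num_real// ler_pXn2r// nnegrE mulr_ge0// ltW.
by rewrite exprMn ler_wpM2l ?sqr_ge0// norm_sqr_le_precond.
Qed.

Lemma precond_eq0 (x : Y) : P alpha x x = 0 -> x = 0.
Proof.
move=> x0; apply/eqP; rewrite -normr_eq0 -sqrf_eq0 eq_le sqr_ge0 andbT.
by rewrite (le_trans (norm_sqr_le_precond x))// x0 mulr0.
Qed.

(** [precond_inv] is the Riesz map of [P]: definiteness gives injectivity, completeness gives
    surjectivity. *)
Lemma precond_inv_bij : bijective (precond_inv C k alpha).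
Proof.
have PP := precond_pre_inner.
apply: bijective_inj_surj => [x y xy|f].
  apply/eqP; rewrite -subr_eq0; apply/eqP/precond_eq0.
  rewrite (innerBl PP); apply/eqP; rewrite subr_eq0; apply/eqP.
  exact: (congr1 (fun f : dual Y => f (x - y)) xy).
have [M M0 fM] := dual_bounded_precond f.
have [x xf] := riesz_representation PP precond_complete (dual_scalar f) M0 fM.
by exists x; apply: dual_eq.
Qed.

(** Turns the definition through [pinv] into a usable identity: [precond] returns the Riesz
    representative for [P]. *)
Lemma precondE (f : dual Y) y : P alpha (precond C k alpha f) y = f y.
Proof.
have [g _ gK] := precond_inv_bij.
have fS : f \in range (precond_inv C k alpha).
  by rewrite inE; exists (g f) => //; exact: gK.
have e : precond_inv C k alpha (precond C k alpha f) = f by exact: pinvK.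
exact: (congr1 (fun h : dual Y => h y) e).
Qed.
End alpha.

(** * The inf-sup condition, uniformly in [alpha] *)

(** Dual to d d = 0; it makes the Poincare inequality applicable to the component d^* z. *)
Lemma hc_dadj_dadj (z : C (k + 1)) :
  hc_dadj C (k - 1) k (hc_dadj C k (k + 1) z) = 0.
Proof.
apply: hc_ip_eq0.
rewrite (hc_dadjE (subrK 1 k)) hc_dadjE//.
by rewrite (hc_dd (subrK 1 k) erefl) linear0r.
Qed.

Lemma hc_ip_parallelogram j (u v : C j) :
  '[u + v, u + v] + '[u - v, u - v] = 2 * '[u, u] + 2 * '[v, v].
Proof.
by rewrite !(hc_ipBl, hc_ipBr, hc_ipDl, hc_ipDr); ring.
Qed.

Lemma poincare_nneg (i j l : int) :
  poincare_inequality C -> i + 1 = j -> j + 1 = l ->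
  exists2 K : R, 0 <= K & forall u : C j, hc_dadj C i j u = 0 ->
    '[u, u] <= K * '[hc_d C j l u, hc_d C j l u].
Proof.
move=> Cp ij jl; have [K KP] := Cp i j l ij jl; exists `|K| => // u /KP.
by move/le_trans; apply; rewrite ler_wpM2r ?hc_ip_ge0// ler_norm.
Qed.

(** Each part of [y] produces one square in [a alpha x y]: u gives |d u|^2, (1 + alpha) d p gives (1
    + alpha) |d p|^2, the multiple e w gives e |d w|^2 by orthogonality, and -p gives alpha |p|^2
    while cancelling (d p, u). The Poincare inequality recovers d^* z from d u. Only the cross term
    alpha e (p, w) has to be absorbed. *)
Lemma hodge_inf_sup :
  poincare_inequality C -> hodge_decomposition C ->
  exists2 c : R, 0 < c & forall alpha, 0 < alpha -> forall x : Y,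
    exists y : Y, P alpha x x <= c * a alpha x y /\
      P alpha y y <= c * P alpha x x.
Proof.
move=> Cp Ch.
have [K1 K1_ge0 K1P] := poincare_nneg Cp (subrK 1 k) erefl.
have [K2 K2_ge0 K2P] := poincare_nneg Cp (subrK 1 (k - 1)) (subrK 1 k).
(* [K1] pays for d^* z. Half of e |d w|^2 survives the absorption and must cover (1 + K2) e |d w|^2,
   whence [2 * K2]. The 6 comes from the bound on [P alpha y y]. *)
exists (6 + K1 + 2 * K2) => [|alpha alpha0 x]; first by lra.
have [[w z] /= [[uE w0 _ wz0] _]] :=
  Ch _ _ _ _ _ (subrK 1 (k - 1)) (subrK 1 k) erefl erefl x.1.
set u1 := hc_dadj C k (k + 1) z in uE wz0.
have u1P := K1P _ (hc_dadj_dadj z : hc_dadj _ _ _ u1 = 0).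
have wP := K2P _ w0.
have du : dk x.1 = dk u1.
  by rewrite uE linearD /= (hc_dd (subrK 1 k) erefl) add0r.
have uw : '[x.1, dk1 w] = '[dk1 w, dk1 w].
  by rewrite uE linearDl /= (hc_ip_sym u1) wz0 addr0.
have uu : '[x.1, x.1] = '[dk1 w, dk1 w] + '[u1, u1].
  rewrite {1}uE linearDl /= (hc_ip_sym _ x.1) uw; congr (_ + _).
  by rewrite uE linearDr /= (hc_ip_sym u1) wz0 add0r.
rewrite -du in u1P.
(* Small enough that [alpha * e * K2 <= 1], which absorbs the cross term, yet equal to
   [(1 + alpha)^-1] up to the factor [1 + K2], so e |d w|^2 still controls the weighted norm of d
   w. *)
pose e := ((1 + alpha) * (1 + K2))^-1.
pose y : Y := (x.1 + (1 + alpha) *: dk1 x.2, e *: w - x.2).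
have aE : a alpha x y = '[dk x.1, dk x.1] + (1 + alpha) * '[dk1 x.2, dk1 x.2] +
   e * '[dk1 w, dk1 w] + alpha * '[x.2, x.2] - alpha * e * '[x.2, w].
  rewrite /hodge_form /y /= linearD linearZ linearB linearZ /=.
  rewrite (hc_dd (subrK 1 k) erefl) scaler0 addr0.
  rewrite !(hc_ipBr, hc_ipDr, hc_ipZr) uw (hc_ip_sym x.1).
  by ring.
have alpha1 : 0 < 1 + alpha by lra.
have K21 : 0 < 1 + K2 by lra.
have du_ge0 := hc_ip_ge0 (dk x.1).
have [p_ge0 dp_ge0] := (hc_ip_ge0 x.2, hc_ip_ge0 (dk1 x.2)).
have [dw_ge0 u1_ge0] := (hc_ip_ge0 (dk1 w), hc_ip_ge0 u1).
have ew_p : 2 * e * '[x.2, w] <= '[x.2, x.2] + e ^+ 2 * '[w, w].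
  have := hc_ip_ge0 (e *: w - x.2).
  rewrite !(hc_ipBl, hc_ipBr, hc_ipZl, hc_ipZr) (hc_ip_sym w); lra.
have y1P : '[y.1, y.1] <=
    2 * '[x.1, x.1] + 2 * (1 + alpha) ^+ 2 * '[dk1 x.2, dk1 x.2].
  have := hc_ip_parallelogram x.1 ((1 + alpha) *: dk1 x.2).
  have := hc_ip_ge0 (x.1 - (1 + alpha) *: dk1 x.2).
  by rewrite hc_ipZl hc_ipZr /=; lra.
have y2P : '[y.2, y.2] <= 2 * e ^+ 2 * '[w, w] + 2 * '[x.2, x.2].
  have := hc_ip_parallelogram (e *: w) x.2.
  have := hc_ip_ge0 (e *: w + x.2).
  by rewrite hc_ipZl hc_ipZr /=; lra.
have dyE : dk y.1 = dk x.1.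
  by rewrite /= linearD linearZ /= (hc_dd (subrK 1 k) erefl) scaler0 addr0.
have dy2E : dk1 y.2 = e *: dk1 w - dk1 x.2 by rewrite /= linearB linearZ.
have dy2P : '[dk1 y.2, dk1 y.2] <=
    2 * e ^+ 2 * '[dk1 w, dk1 w] + 2 * '[dk1 x.2, dk1 x.2].
  have := hc_ip_parallelogram (e *: dk1 w) (dk1 x.2).
  have := hc_ip_ge0 (e *: dk1 w + dk1 x.2).
  by rewrite dy2E hc_ipZl hc_ipZr; lra.
exists y; rewrite /precond_form aE dyE uu.
rewrite uu in y1P.
pose i := (1 + alpha)^-1; rewrite -/i.
have i_gt0 : 0 < i by rewrite invr_gt0.
have i_le1 : i <= 1 by rewrite invf_le1// lerDl ltW.
have iE : i = (1 + K2) * e by rewrite /i /e; field; rewrite !gt_eqF.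
have aiE : (1 + alpha) * i = 1 by rewrite divff// gt_eqF.
have e_gt0 : 0 < e by rewrite invr_gt0 mulr_gt0.
move: '[dk x.1, dk x.1] '[dk1 x.2, dk1 x.2] '[x.2, x.2] '[dk1 w, dk1 w]
  '[w, w] '[x.2, w] '[u1, u1] '[y.1, y.1] '[y.2, y.2] '[dk1 y.2, dk1 y.2]
  du_ge0 dp_ge0 p_ge0 dw_ge0 u1_ge0 ew_p y1P y2P dy2P wP u1P.
clearbody i e.
clear -alpha0 alpha1 K1_ge0 K2_ge0 K21 i_gt0 i_le1 iE aiE e_gt0.
(* Only real arithmetic remains: [A] = |d u|^2, [D] = |d p|^2, [Q] = |p|^2, [U0] = |d w|^2, [W] =
   |w|^2, [r] = (p, w), [U1] = |d^* z|^2; [Y1], [Y2], [DY2] belong to [y.1], [y.2] and d [y.2]. *)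
move=> A D Q U0 W r U1 Y1 Y2 DY2 A_ge0 D_ge0 Q_ge0 U0_ge0 U1_ge0.
move=> rP Y1P Y2P DY2P WP U1P.
pose G := e * U0; pose B := (1 + alpha) * D; pose S := alpha * Q.
have G_ge0 : 0 <= G by rewrite mulr_ge0// ltW.
have B_ge0 : 0 <= B by rewrite mulr_ge0// ltW.
have S_ge0 : 0 <= S by rewrite mulr_ge0// ltW.
have iU0 : i * U0 = (1 + K2) * G by rewrite iE /G mulrA.
have iU1 : i * U1 <= K1 * A.
  by rewrite (le_trans _ U1P)// ler_piMl.
have ae : alpha * e * K2 <= 1.
  have -> : alpha * e * K2 = alpha * ((1 + K2) * e) - alpha * e by ring.
  by rewrite -iE; have : 0 <= alpha * e; [rewrite mulr_ge0// ltW|lra].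
have aeW : alpha * e ^+ 2 * W <= G.
  rewrite (_ : _ * W = e * (alpha * e * W)); last by ring.
  rewrite ler_pM2l// (le_trans (_ : _ <= alpha * e * (K2 * U0)))//.
    by rewrite ler_pM2l// mulr_gt0.
  by rewrite mulrA ler_piMl.
have ar : 2 * (alpha * e * r) <= S + G.
  have : alpha * (2 * e * r) <= alpha * (Q + e ^+ 2 * W) by rewrite ler_pM2l.
  by rewrite /S; lra.
have iY1 : i * Y1 <= 2 * (i * (U0 + U1)) + 2 * B.
  have : i * Y1 <= i * (2 * (U0 + U1) + 2 * (1 + alpha) ^+ 2 * D).
    by rewrite ler_pM2l.
  rewrite (_ : i * (_ + _) = 2 * (i * (U0 + U1)) +
    2 * (((1 + alpha) * i) * (1 + alpha) * D)); last by ring.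
  by rewrite aiE mul1r.
have aY2 : alpha * Y2 <= 2 * G + 2 * S.
  have : alpha * Y2 <= alpha * (2 * e ^+ 2 * W + 2 * Q) by rewrite ler_pM2l.
  by rewrite /S; lra.
have aDY2 : (1 + alpha) * DY2 <= 2 * G + 2 * B.
  have : (1 + alpha) * DY2 <= (1 + alpha) * (2 * e ^+ 2 * U0 + 2 * D).
    by rewrite ler_pM2l.
  have : (1 + alpha) * e * G <= G.
    rewrite ler_piMl// -[leRHS]aiE ler_pM2l// iE.
    have : 0 <= K2 * e by rewrite mulr_ge0// ltW.
    by lra.
  by rewrite /G /B; lra.
(* Products with [K1] and [K2] are supplied explicitly, as the closing steps are linear
   arithmetic. *)
have K1n : 0 <= K1 * (B + G / 2 + S / 2) by rewrite mulr_ge0//; lra.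
have K2n : 0 <= K2 * (A + B + S / 2) by rewrite mulr_ge0//; lra.
have K3n : 0 <= (K1 + 2 * K2) * (i * (U0 + U1) + A + S + B).
  have iU : 0 <= i * (U0 + U1) by rewrite mulr_ge0 ?addr_ge0// ltW.
  by rewrite mulr_ge0//; lra.
have K4n : 0 <= K2 * G by rewrite mulr_ge0.
have iU1n : 0 <= i * U1 by rewrite mulr_ge0// ltW.
have iUE : i * (U0 + U1) = (1 + K2) * G + i * U1 by rewrite mulrDr iU0.
have c0 : 0 < 6 + K1 + 2 * K2 by lra.
(* Absorbing the cross term costs half of [G] and half of [S]. *)
have aP : A + B + G / 2 + S / 2 <= A + B + G + S - alpha * e * r by lra.
have {}aP := ler_wpM2l (ltW c0) aP.
rewrite -/B -/S -/G; split.
  by apply: le_trans aP; rewrite iUE; lra.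
by move: K3n iY1; rewrite iUE; lra.
Qed.
End hodge_laplacian_theory.

(** * The preconditioned operator: bounds, bijectivity and condition number *)

Lemma seq_complete_equiv (R : realType) (E : lmodType R) (b1 b2 : E -> E -> R)
    (M N : R) :
  0 < M -> 0 < N -> (forall x, b1 x x <= M * b2 x x) ->
  (forall x, b2 x x <= N * b1 x x) -> seq_complete b1 -> seq_complete b2.
Proof.
move=> M0 N0 b12 b21 b1C u uC.
have [|x xP] := b1C u.
  move=> e e0; have [n nP] := uC (e / M) (divr_gt0 e0 M0).
  exists n => i j ni nj.
  by rewrite (le_trans (b12 _))// mulrC -ler_pdivlMr// nP.
exists x => e e0; have [n nP] := xP (e / N) (divr_gt0 e0 N0).
exists n => m nm.
by rewrite (le_trans (b21 _))// mulrC -ler_pdivlMr// nP.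
Qed.

Lemma opnorm_le (R : realType) (V : lmodType R) (ip : V -> V -> R) (T : V -> V)
    (M : R) : 0 <= M -> (forall v, ip (T v) (T v) <= M * ip v v) ->
  (opnorm ip T <= (Num.sqrt M)%:E)%E.
Proof.
move=> M0 TM; apply: ge_ereal_sup => _ [v /= v1 <-]; rewrite lee_fin.
rewrite (le_trans (ler_wsqrtr (TM v)))// sqrtrM//.
by rewrite ler_piMr// sqrtr_ge0.
Qed.

(** The vector 0 lies in the unit ball. Nonnegativity is used to multiply bounds in the extended
    reals. *)
Lemma opnorm_ge0 (R : realType) (V : lmodType R) (ip : V -> V -> R)
    (T : V -> V) : ip 0 0 = 0 -> (0 <= opnorm ip T)%E.
Proof.
move=> ip0; apply: (@le_trans _ _ (ip_norm ip (T 0))%:E).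
  by rewrite lee_fin sqrtr_ge0.
by apply: ereal_sup_ubound; exists 0 => //=; rewrite /ip_norm ip0 sqrtr0.
Qed.

Section preconditioned.
Context {R : realType} (C : hilbert_complex R) (k : int).
Context (alpha : R) (alpha0 : 0 < alpha).

Local Notation Y := (hodge_space C k).
Local Notation P := (precond_form C k alpha).
Local Notation a := (hodge_form C k alpha).
Local Notation T := (precond C k alpha \o hodge_op C k alpha).

Let PP : pre_inner (P : Y -> Y -> R) := precond_pre_inner C k alpha0.

Lemma precond_hodgeE x y : P (T x) y = a x y.
Proof. exact: precondE. Qed.

(** Continuity of [a] tested with [y = T x], where [a x (T x) = P (T x) (T x)]; one factor
    [P (T x) (T x)] then cancels. *)
Lemma precond_hodge_le x : P (T x) (T x) <= 4 * P x x.
Proof.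
have := hodge_form_bound alpha0 x (T x); rewrite -precond_hodgeE.
have := inner_ge0 PP (T x); have := inner_ge0 PP x.
move: (P x x) (P (T x) (T x)) => p s p0 s_ge0.
have [->|s_neq0] := eqVneq s 0; first by rewrite mulr_ge0.
by rewrite expr2 mulrA ler_pM2r// lt_neqAle eq_sym s_neq0.
Qed.

Context (c : R) (c0 : 0 < c).
Context (inf_sup : forall x : Y, exists y : Y,
  P x x <= c * a x y /\ P y y <= c * P x x).

(** With p = [P x x], s = [P (T x) (T x)] and the inf-sup partner [y]: p^2 <= c^2 (a x y)^2 <= c^2 s
    [P y y] <= c^3 s p, and p cancels. *)
Lemma precond_hodge_ge x : P x x <= c ^+ 3 * P (T x) (T x).
Proof.
have [y [xy yx]] := inf_sup x.
have := inner_CS PP (T x) y; rewrite precond_hodgeE.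
have := inner_ge0 PP (T x); have := inner_ge0 PP x.
move: (P x x) (P y y) (a x y) (P (T x) (T x)) xy yx => p q r s pr qp p0 s0 rs.
have [->|pn0] := eqVneq p 0; first by rewrite mulr_ge0// exprn_ge0// ltW.
have {}p0 : 0 < p by rewrite lt_neqAle eq_sym pn0.
rewrite -(ler_pM2r p0) -expr2.
have h1 : p ^+ 2 <= (c * r) ^+ 2.
  by rewrite ler_pXn2r// nnegrE ?(ltW p0)// (le_trans (ltW p0)).
have h2 : c ^+ 2 * r ^+ 2 <= c ^+ 2 * (s * (c * p)).
  by rewrite ler_pM2l ?exprn_gt0// (le_trans rs)// ler_wpM2l.
rewrite (le_trans h1)// exprMn (le_trans h2)// le_eqVlt; apply/orP; left.
by apply/eqP; ring.
Qed.

Lemma hodge_op_bij : bijective (hodge_op C k alpha).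
Proof.
apply: bijective_inj_surj => [x y xy|f].
  apply/eqP; rewrite -subr_eq0; apply/eqP; apply: (precond_eq0 alpha0).
  have [z [xyz _]] := inf_sup (x - y).
  apply/eqP; rewrite eq_le (inner_ge0 PP) andbT (le_trans xyz)//.
  rewrite hodge_form_sym -scaleN1r addrC hodge_form_scalar/=.
  rewrite !(hodge_form_sym _ z).
  have -> : a x z = a y z := congr1 (fun f : dual Y => f z) xy.
  by rewrite mulN1r addNr mulr0.
pose b x y := P (T x) (T y).
(* Symmetry of [P] and of [a] makes [T] self-adjoint for [P]. *)
have bE x y : b x y = a (T x) y.
  by rewrite /b (inner_sym PP) precond_hodgeE hodge_form_sym.
have bP : pre_inner (b : Y -> Y -> R).
  split=> [x y|x t y z|x]; first exact: (inner_sym PP).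
    by rewrite !bE; exact: hodge_form_scalar.
  exact: (inner_ge0 PP).
have c30 : 0 < c ^+ 3 by rewrite exprn_gt0.
have bC : seq_complete (b : Y -> Y -> R).
  apply: (@seq_complete_equiv _ _ (P : Y -> Y -> R) _ (c ^+ 3) 4) => //.
  - exact: precond_hodge_ge.
  - exact: precond_hodge_le.
  - exact: precond_complete.
have [M M0 fM] := dual_bounded_precond alpha0 f.
have fb (x : Y) : f x ^+ 2 <= (M * c ^+ 3) * b x x.
  by rewrite (le_trans (fM x))// -mulrA ler_wpM2l// precond_hodge_ge.
have [x xf] := riesz_representation bP bC (dual_scalar f)
  (mulr_ge0 M0 (ltW c30)) fb.
(* The representative satisfies [f y = b x y = a (T x) y], so the preimage of [f] is [T x] rather
   than [x]. *)
by exists (T x); apply: dual_eq => y; rewrite -xf bE.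
Qed.

(** [pinv] inverts [T] on its range, and [T] is onto: the preimage of [x] solves the Hodge-Laplace
    problem with right-hand side [precond_inv C k alpha x]. *)
Lemma precond_hodge_pinvK x : T (pinv setT T x) = x.
Proof.
have [g _ gK] := hodge_op_bij.
have xT : x \in range T.
  rewrite inE; exists (g (precond_inv C k alpha x)) => //=.
  have inj := bij_inj (precond_inv_bij C k alpha0).
  apply: inj; apply: dual_eq => y /=.
  by rewrite precondE// gK.
exact: pinvK.
Qed.

Lemma condition_number_precond_hodge_le :
  (condition_number C k alpha T <= (Num.sqrt 4 * Num.sqrt (c ^+ 3))%:E)%E.
Proof.
have P0 : P 0 0 = 0 by exact: (innerr0 PP).
rewrite /condition_number EFinM lee_pmul ?opnorm_ge0//.
  by apply: opnorm_le => //; exact: precond_hodge_le.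
apply: opnorm_le => [|x]; first by rewrite exprn_ge0// ltW.
by have := precond_hodge_ge (pinv setT T x); rewrite precond_hodge_pinvK.
Qed.
End preconditioned.

Theorem theorem4p4 (R : realType) (C : hilbert_complex R)
    (Cexact : exact_complex C)
    (Cpoincare : poincare_inequality C)
    (Chodge : hodge_decomposition C)
    (k : int) (k_ge1 : 1 <= k) :
  exists c : R, 1 <= c /\
    forall alpha : R, 0 < alpha ->
      [/\ bijective (precond_inv C k alpha),
          bijective (hodge_op C k alpha) &
          (condition_number C k alpha
             (precond C k alpha \o hodge_op C k alpha)
           <= c%:E)%E].
Proof.
have [c c0 inf_sup] := hodge_inf_sup k Cpoincare Chodge.
(* The maximum secures [1 <= c]; the other entry is the product of the bounds for [T] and its
   inverse, with the inf-sup constant chosen before [alpha]. *)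
exists (Num.max 1 (Num.sqrt 4 * Num.sqrt (c ^+ 3))).
split=> [|alpha alpha0]; first by rewrite le_max lexx.
have {}inf_sup := inf_sup alpha alpha0.
split; [exact: precond_inv_bij|exact: hodge_op_bij inf_sup|].
rewrite (le_trans (condition_number_precond_hodge_le alpha0 c0 inf_sup))//.
by rewrite lee_fin le_max lexx orbT.
Qed.
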